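(* Let $R$ be a noetherian integral domain with $|R|>2^{\aleph_0}$. Then $R$ is a $u$-ring.
   Context: All rings are commutative with $1\neq 0$. An ideal $I$ of a ring $R$ is a $u$-ideal if whenever $J_1,\ldots,J_n$ are finitely many ideals of $R$ with $I\subseteq\bigcup_{k=1}^n J_k$, then $I\subseteq J_k$ for some $k$. A ring $R$ is a $u$-ring if every ideal of $R$ is a $u$-ideal. *)

(* Defs.v *)
From HB Require Import structures.
From mathcomp Require Import all_boot all_order all_algebra.
From mathcomp Require Import boolp classical_sets functions cardinality.

Set Implicit Arguments.
Unset Strict Implicit.
Unset Printing Implicit Defensive.

Import GRing.Theory.

Local Open Scope classical_set_scope.
Local Open Scope ring_scope.
Local Open Scope card_scope.

(* [idealr] of mathcomp's ring_quotient only covers proper ideals given by a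
   boolean predicate; here the unit ideal is an ideal as well. *)
Definition is_ideal (R : comNzRingType) (I : set R) : Prop :=
  [/\ I 0,
      forall x y : R, I x -> I y -> I (x + y)
    & forall a x : R, I x -> I (a * x)].

(* [smallest is_ideal G] is the ideal generated by [G]. *)
Definition noetherian (R : comNzRingType) : Prop :=
  forall I : set R, is_ideal I ->
    exists2 G : set R, finite_set G & I = smallest (@is_ideal R) G.

(* The case n = 0 is vacuous, since an ideal is never empty. *)
Definition u_ideal (R : comNzRingType) (I : set R) : Prop :=
  forall (n : nat) (J : 'I_n -> set R),
    (forall k, is_ideal (J k)) ->
    I `<=` \bigcup_(k in [set: 'I_n]) J k ->
    exists k, I `<=` J k.

Definition u_ring (R : comNzRingType) : Prop :=
  forall I : set R, is_ideal I -> u_ideal I.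

Definition card_lt (T U : Type) (A : set T) (B : set U) : Prop :=
  A #<= B /\ ~ (B #<= A).

(* Main.v *)
Require Import Defs.
From mathcomp Require Import all_boot all_order all_algebra.
From mathcomp Require Import boolp classical_sets functions cardinality.
From mathcomp Require Import ring.

(** Suppose that an ideal [I] is covered by finitely many ideals, none of which
    contains [I].  An abelian group covered by finitely many cosets of
    subgroups is already covered by finitely many cosets of one of them
    (B. H. Neumann, [coset_covering]), so some [J k `&` I] has finite index in
    [I].  For [x] in [I] outside [J k], multiplication by [x] embeds
    [R / (J k : x)] into the finite group [I / (J k `&` I)], and [(J k : x)] is
    a proper ideal of finite index ([countable_index_of_union]).

    A noetherian domain with more than continuum many elements has no proper
    ideal [P] of finite, or even countable, index ([card_le_continuum]).
    Indeed let [P] be generated by [x_1, ..., x_m] and let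
    [P_n := (x_1 ^ n, ..., x_m ^ n)].  All the [P_n] have countable index
    ([countable_index_pow]), and they intersect in [0]: this is Krull's
    intersection theorem, [P_n] being cofinal with the powers of [P]
    ([krull_intersection]).  Hence [R] embeds into a countable product of
    countable sets, which has at most continuum many elements.

    The ideals [P_n] replace the powers [P ^ n] because both facts about them
    are then proved by treating one generator at a time. *)

(** * Covering a group by cosets *)

Section CosetCovering.
Import GRing.Theory.
Local Open Scope classical_set_scope.
Local Open Scope ring_scope.

(** By induction on the number of subgroups.  If finitely many cosets of [H k]
    do not cover [A], some coset [x0 + H k] misses all of those used, hence is
    covered by cosets of the other subgroups; every coset of [H k] is a
    translate of it, so [H k] can be dispensed with.  A single list [cs] of
    centres serves for all the subgroups, which loses nothing. *)
Lemma coset_covering {V : zmodType} {T : eqType} (A : set V) (H : T -> set V)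
    (ks : seq T) (cs : seq V) :
    A 0 -> (forall x y, A x -> A y -> A (x + y)) ->
    (forall k, H k `<=` A) ->
    (forall k x y, H k x -> H k y -> H k (x - y)) ->
    (forall x, A x -> exists k c, [/\ k \in ks, c \in cs & H k (x - c)]) ->
  exists (k : T) (cs' : seq V),
    forall x, A x -> exists2 c, c \in cs' & H k (x - c).
Proof.
move=> A0 AD HA HB; elim: ks cs => [|k ks IH] cs covA.
  by have [? [? []]] := covA _ A0.
have [covk|] := pselect (forall x, A x -> exists2 c, c \in cs & H k (x - c)).
  by exists k, cs.
move=> /existsNP [x0] /not_implyP [Ax0 x0NH].
apply: (IH (cs ++ [seq c + (c' - x0) | c <- cs, c' <- cs])) => y Ay.
have [k1 [c [k1ks ccs Hyc]]] := covA _ Ay.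
move: k1ks; rewrite in_cons => /orP [/eqP k1E|k1ks]; last first.
  by exists k1, c; rewrite mem_cat ccs.
rewrite {}k1E {k1} in Hyc.
(* [x0 + (y - c)] lies in the missed coset of [H k]: cover it instead. *)
have [k2 [c' [k2ks c'cs Hx0]]] := covA _ (AD _ _ Ax0 (HA _ _ Hyc)).
move: k2ks; rewrite in_cons => /orP [/eqP k2E|k2ks].
  case: x0NH; exists c' => //.
  rewrite k2E in Hx0; have := HB _ _ _ Hx0 Hyc.
  by rewrite addrAC addrK.
exists k2, (c + (c' - x0)); split=> //.
  by rewrite mem_cat; apply/orP; right; apply/allpairsP; exists (c, c').
suff -> : y - (c + (c' - x0)) = x0 + (y - c) - c' by [].
by rewrite opprD opprB [x0 + (y - c)]addrC !addrA.
Qed.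

End CosetCovering.

(** * Generated ideals *)

Section IdealSpan.
Import GRing.Theory.
Local Open Scope classical_set_scope.
Local Open Scope ring_scope.
Context {R : comNzRingType}.
Implicit Types (G I J K : set R) (s : seq R).

Lemma ideal0 {I} : is_ideal I -> I 0. Proof. by case. Qed.

Lemma idealD {I} : is_ideal I -> forall x y, I x -> I y -> I (x + y).
Proof. by case. Qed.

Lemma idealM {I} : is_ideal I -> forall a x, I x -> I (a * x).
Proof. by case. Qed.

Lemma idealB {I} : is_ideal I -> forall x y, I x -> I y -> I (x - y).
Proof.
by move=> idI x y Ix Iy; rewrite -mulN1r; apply: (idealD idI) => //; apply: idealM.
Qed.

Definition ideal_span G : set R := smallest (@is_ideal R) G.

Lemma ideal_span_ideal G : is_ideal (ideal_span G).
Proof.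
split=> [K [idK _]|x y Gx Gy K GK|a x Gx K GK].
- exact: ideal0.
- by apply: idealD; [exact: GK.1 | exact: Gx | exact: Gy].
- by apply: idealM; [exact: GK.1 | exact: Gx].
Qed.

Lemma ideal_span_gen G : G `<=` ideal_span G.
Proof. exact: sub_gen_smallest. Qed.

Lemma ideal_span_sub G K : is_ideal K -> G `<=` K -> ideal_span G `<=` K.
Proof. exact: smallest_sub. Qed.

Lemma ideal_span_mono G G' : G `<=` G' -> ideal_span G `<=` ideal_span G'.
Proof.
move=> GG'; apply: ideal_span_sub; first exact: ideal_span_ideal.
by move=> x /GG'; exact: ideal_span_gen.
Qed.

Lemma ideal_spanU1 G h x :
  ideal_span (G `|` [set h]) x -> exists a, ideal_span G (x - a * h).
Proof.
have idG := ideal_span_ideal G.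
apply: (ideal_span_sub _ [set x | exists a, ideal_span G (x - a * h)]).
  split=> [|y z [a Ga] [b Gb]|c y [a Ga]].
  - by exists 0; rewrite mul0r subr0; exact: ideal0.
  - exists (a + b); have := idealD idG _ _ Ga Gb.
    by congr (ideal_span G _); ring.
  - exists (c * a); have := idealM idG c _ Ga.
    by congr (ideal_span G _); ring.
move=> y [Gy|->]; first by exists 0; rewrite mul0r subr0; exact: ideal_span_gen.
by exists 1; rewrite mul1r subrr; exact: ideal0.
Qed.

End IdealSpan.

(** * Ideals of countable index *)

Section CountableIndex.
Import GRing.Theory.
Local Open Scope classical_set_scope.
Local Open Scope ring_scope.
Context {R : comNzRingType}.
Implicit Types (G I J K : set R) (s : seq R).

(** The function [f] labels the cosets of [I] by natural numbers; a coset may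
    bear several labels, which spares choosing a canonical one. *)
Definition countable_index I :=
  exists f : R -> nat, forall x y, f x = f y -> I (x - y).

Lemma countable_indexS I J : I `<=` J -> countable_index I -> countable_index J.
Proof. by move=> IJ [f fI]; exists f => x y /fI /IJ. Qed.

(** In passing from [G + (h ^ n)] to [G + (h ^ n.+1)], an element is determined
    by its class modulo [G + (h ^ n)] and by the class modulo [G + (h)] of the
    coefficient of [h ^ n] in its difference with a representative. *)
Lemma countable_index_pow1 G h n :
  countable_index (ideal_span (G `|` [set h])) ->
  countable_index (ideal_span (G `|` [set h ^+ n])).
Proof.
move=> [f fP]; elim: n => [|n [g gP]].
  exists (fun=> 0%N) => x y _; rewrite -[x - y]mulr1.
  by apply: (idealM (ideal_span_ideal _)); apply: ideal_span_gen; right.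
(* [r m] is a fixed element bearing the label [m], if there is one. *)
have /choice [r rP] : forall m, exists r, (exists x, g x = m) -> g r = m.
  move=> m; have [[x gx]|nx] := pselect (exists x, g x = m).
    by exists x.
  by exists 0 => /nx.
have rE x : g (r (g x)) = g x by apply: rP; exists x.
have /choice [a aP] x :
    exists a, ideal_span G (x - r (g x) - a * h ^+ n).
  by apply: ideal_spanU1; apply: gP; rewrite rE.
exists (fun x => pickle (g x, f (a x))) => x y.
move=> /(pcan_inj (@pickleK _)) [gxy /fP /ideal_spanU1 [b bP]].
set K := ideal_span (_ `|` _); have idK : is_ideal K := ideal_span_ideal _.
have GK : ideal_span G `<=` K by apply: ideal_span_mono => z Gz; left.
have -> : x - y = (x - r (g x) - a x * h ^+ n) - (y - r (g y) - a y * h ^+ n)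
    + (h ^+ n * (a x - a y - b * h) + b * h ^+ n.+1).
  by rewrite gxy exprS; ring.
apply: (idealD idK); first by apply: (idealB idK); apply: GK; apply: aP.
apply: (idealD idK); apply: (idealM idK); first exact: GK.
by apply: ideal_span_gen; right.
Qed.

Lemma countable_index_pow G s n :
  countable_index (ideal_span (G `|` [set` s])) ->
  countable_index (ideal_span (G `|` [set` [seq x ^+ n | x <- s]])).
Proof.
elim: s G => [|h s IH] G //= cG.
have : countable_index (ideal_span ((G `|` [set h]) `|` [set` s])).
  apply: countable_indexS cG; apply: ideal_span_mono => x [Gx|/=].
    by left; left.
  by rewrite in_cons => /orP [/eqP ->|xs]; [left; right | right].
move=> /IH; rewrite setUAC => /countable_index_pow1 - /(_ n).
apply: countable_indexS; apply: ideal_span_mono => x [[Gx|/= xs]|->] /=.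
- by left.
- by right; rewrite /= in_cons xs orbT.
- by right; rewrite /= in_cons eqxx.
Qed.

End CountableIndex.

(** * Krull's intersection theorem *)

Section KrullIntersection.
Import GRing.Theory.
Local Open Scope classical_set_scope.
Local Open Scope ring_scope.
Context {R : comNzRingType} (hN : noetherian R).
Implicit Types (G I J K : set R) (s : seq R).

Lemma noetherian_chain (I : nat -> set R) :
  (forall n, is_ideal (I n)) -> (forall n, I n `<=` I n.+1) ->
  exists n, forall m, I m `<=` I n.
Proof.
move=> idI Imon.
have Ile m n : (m <= n)%N -> I m `<=` I n.
  move=> /subnK <-; elim: (n - m)%N => [|k IH] // x /IH; exact: Imon.
have idU : is_ideal (\bigcup_n I n).
  split=> [|x y [m _ mx] [n _ ny]|a x [m _ mx]].
  - by exists 0%N => //; exact: ideal0.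
  - exists (maxn m n) => //; apply: idealD => //.
      exact: Ile (leq_maxl _ _) _ mx.
    exact: Ile (leq_maxr _ _) _ ny.
  - by exists m => //; exact: idealM.
have [_ /finite_seqP [s ->] UE] := hN _ idU.
have sU x : x \in s -> exists n, I n x.
  move=> xs; have : (\bigcup_n I n) x by rewrite UE; exact: ideal_span_gen.
  by case=> n; exists n.
have [n sn] : exists n, forall x, x \in s -> I n x.
  elim: s {UE} sU => [|x s IH] sU; first by exists 0%N.
  have [|n sn] := IH; first by move=> y ys; apply: sU; rewrite in_cons ys orbT.
  have [|m mx] := sU x; first exact: mem_head.
  exists (maxn m n) => y; rewrite in_cons => /orP [/eqP ->|/sn].
    exact: Ile (leq_maxl _ _) _ mx.
  exact: Ile (leq_maxr _ _) _.
exists n => m x Imx; have : (\bigcup_n I n) x by exists m.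
by rewrite UE; apply: ideal_span_sub.
Qed.

(** The ideals [(G : x ^ n)] increase with [n], hence stabilise at some [n].
    If [b = g + a * x ^ n] with [g] in [G], then [x * b] in [G] puts [a] in
    [(G : x ^ n.+1) = (G : x ^ n)], so [a * x ^ n] and [b] are in [G]. *)
Lemma span_pow_absorb G x b :
  ideal_span G (x * b) ->
  exists n, ideal_span (G `|` [set x ^+ n]) b -> ideal_span G b.
Proof.
have idG := ideal_span_ideal G => xbG.
have [||n nP] := noetherian_chain (fun n => [set r | ideal_span G (x ^+ n * r)]).
- move=> n; split=> [|r t Gr Gt|a r Gr] /=.
  + by rewrite mulr0; exact: ideal0 idG.
  + by rewrite mulrDr; exact: (idealD idG).
  + by rewrite mulrCA; exact: (idealM idG).
- by move=> n r /= Gr; rewrite exprS -mulrA; exact: (idealM idG).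
exists n => /ideal_spanU1 [a Ga].
have : ideal_span G (x ^+ n * a).
  apply: (nP n.+1); rewrite /= exprS.
  have -> : x * x ^+ n * a = x * b - x * (b - a * x ^+ n) by ring.
  by apply: (idealB idG) => //; exact: (idealM idG).
by move=> /(idealD idG _ _ Ga); rewrite [x ^+ n * a]mulrC subrK.
Qed.

(** The powers of the elements of [s] are absorbed one after the other: once
    [m] works for [h] and [G], the induction hypothesis applies to
    [G + (h ^ m)]. *)
Lemma span_pows_absorb G s b :
  (forall x, x \in s -> ideal_span G (x * b)) ->
  (forall n, ideal_span (G `|` [set` [seq x ^+ n | x <- s]]) b) ->
  ideal_span G b.
Proof.
elim: s G => [|h s IH] G sb Gb.
  by apply: ideal_span_mono (Gb 0%N) => x [].
have [|m mP] := span_pow_absorb G h b; first by apply: sb; exact: mem_head.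
apply: mP; apply: IH => [x xs|n].
  apply: (ideal_span_mono G) => [y|]; first by left.
  by apply: sb; rewrite in_cons xs orbT.
set K := ideal_span _; have idK : is_ideal K := ideal_span_ideal _.
(* The exponent [m + n] is at least the one fixed for [h] and the one required
   of the other generators. *)
apply: (ideal_span_sub _ K idK _ _ (Gb (m + n)%N)) => x [Gx|].
  by apply: ideal_span_gen; left; left.
rewrite /= in_cons => /orP [/eqP ->|/mapP [y ys ->]].
  rewrite addnC exprD; apply: (idealM idK).
  by apply: ideal_span_gen; left; right.
rewrite exprD; apply: (idealM idK); apply: ideal_span_gen; right.
by apply/mapP; exists y.
Qed.

(** Absorption applied to the ideal generated by the multiples [x * b] of [b]
    with [x] in [s], which contains [x * b] by design. *)
Lemma krull_intersection s b :
  (forall n, ideal_span [set` [seq x ^+ n | x <- s]] b) ->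
  exists2 p, ideal_span [set` s] p & b = p * b.
Proof.
move=> sb; have idS : is_ideal (ideal_span [set` s]) := ideal_span_ideal _.
have : ideal_span [set x * b | x in [set` s]] b.
  apply: (span_pows_absorb _ s) => [x xs|n].
    by apply: ideal_span_gen; exists x.
  by apply: ideal_span_mono (sb n) => x; right.
apply: (ideal_span_sub _ [set y | exists2 p, ideal_span [set` s] p & y = p * b]).
  split=> [|_ _ [p Sp ->] [q Sq ->]|a _ [p Sp ->]].
  - by exists 0; [exact: ideal0 idS | rewrite mul0r].
  - by exists (p + q); [exact: (idealD idS) | rewrite mulrDl].
  - by exists (a * p); [exact: (idealM idS) | rewrite mulrA].
by move=> _ [x xs <-]; exists x => //; exact: ideal_span_gen.
Qed.

End KrullIntersection.

(** * Proper ideals of a large noetherian domain *)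

Section UncountableIndex.
Import GRing.Theory.
Local Open Scope classical_set_scope.
Local Open Scope ring_scope.
Local Open Scope card_scope.

(** The labels of [x] modulo the ideals generated by the [n]-th powers of the
    generators of [P] determine [x]: a difference [d] of two elements with the
    same labels satisfies [d = p * d] with [p] in [P], and [p <> 1].  The
    sequence of labels is recorded by its graph, a set of codes of pairs. *)
Lemma card_le_continuum {R : idomainType} (P : set R) :
  noetherian R -> is_ideal P -> ~ P 1 -> countable_index P ->
  [set: R] #<= [set: set nat].
Proof.
move=> hN idP P1 cP; have [_ /finite_seqP [s ->] PE] := hN _ idP.
have /choice [f fP] n : exists f : R -> nat, forall x y,
    f x = f y -> ideal_span [set` [seq x ^+ n | x <- s]] (x - y).
  rewrite -[[set` _]]set0U; apply: countable_index_pow.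
  by rewrite set0U /ideal_span -PE.
pose F x : set nat := [set pickle (n, f n x) | n in [set: nat]].
have Finj : injective F.
  move=> x y Fxy; apply/eqP; rewrite -subr_eq0; apply/eqP.
  have [|p Sp pE] := krull_intersection hN s (x - y).
    move=> n; apply: fP; have : F x (pickle (n, f n x)) by exists n.
    by rewrite Fxy => -[m _] /(pcan_inj (@pickleK _)) [->].
  have /eqP : (1 - p) * (x - y) = 0 by rewrite mulrBl mul1r -pE subrr.
  rewrite mulf_eq0 => /orP [|/eqP //]; rewrite subr_eq0 => /eqP p1.
  by case: P1; rewrite PE p1.
have FT : F @` [set: R] #= [set: R] by apply: inj_card_eq => x y _ _; exact: Finj.
by rewrite -(card_le_eql FT); exact: subset_card_le.
Qed.

End UncountableIndex.

(** * Unions of ideals *)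

Section UnionOfIdeals.
Import GRing.Theory.
Local Open Scope classical_set_scope.
Local Open Scope ring_scope.

(** The ideal is [P = (J k : x)], where [J k `&` I] has finite index in [I] and
    [x] is an element of [I] outside [J k]; [r] is labelled by a coset of [J k]
    containing [r * x]. *)
Lemma countable_index_of_union {R : comNzRingType} (I : set R) (n : nat)
    (J : 'I_n -> set R) :
  is_ideal I -> (forall k, is_ideal (J k)) ->
  I `<=` \bigcup_(k in [set: 'I_n]) J k -> (forall k, ~ I `<=` J k) ->
  exists P : set R, [/\ is_ideal P, ~ P 1 & countable_index P].
Proof.
move=> idI idJ IJ IJN.
have [|||k [cs csP]] :=
  coset_covering I (fun k => J k `&` I) (enum 'I_n) [:: 0] (ideal0 idI) (idealD idI).
- by move=> k x [].
- by move=> k x y [Jx Ix] [Jy Iy]; split; exact: idealB.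
- move=> x Ix; have [k _ Jkx] := IJ _ Ix.
  by exists k, 0; rewrite mem_enum mem_head subr0.
have /existsNP [x /not_implyP [Ix NJx]] := IJN k.
exists [set r | J k (r * x)]; split=> /=.
- split=> [|r t|a r] /=; first by rewrite mul0r; exact: ideal0.
    by rewrite mulrDl; exact: idealD.
  by rewrite -mulrA; exact: idealM.
- by rewrite mul1r.
have /choice [c cP] r : exists c, c \in cs /\ J k (r * x - c).
  by have [c ccs []] := csP _ (idealM idI r _ Ix); exists c.
exists (fun r => index (c r) cs) => r t rt /=.
have crt : c r = c t by rewrite -(nth_index 0 (cP r).1) rt nth_index //; case: (cP t).
have -> : (r - t) * x = (r * x - c r) - (t * x - c t) by rewrite crt; ring.
by apply: idealB; [exact: idJ | exact: (cP _).2 | exact: (cP _).2].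
Qed.

End UnionOfIdeals.

(* [set nat], the type of all subsets of nat, has cardinality 2^aleph_0. *)
Theorem corollary2p23 (R : idomainType) (hN : noetherian R)
    (hcard : card_lt [set: set nat] [set: R]) :
  u_ring R.
Proof.
move=> I idI n J idJ IJ; apply: contrapT => /forallNP IJN.
have [P [idP P1 cP]] := countable_index_of_union I n J idI idJ IJ IJN.
by case: hcard => _; apply; exact: card_le_continuum hN idP P1 cP.
Qed.
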